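(* Let $q,a,b$ be nonzero complex numbers with $|q|<1$ and $\max\{|ab/q|,|a|,|b|\}<1$, and let $i=\sqrt{-1}$. Then $$\frac{(q,ab/q;q)_\infty}{(a,b;q)_\infty}\;{}_3\phi_2\left(\begin{matrix}q/a,\,q/b,\,q\\ iq,\,-iq\end{matrix};q,ab/q\right)=1+2\sum_{n=1}^{\infty}\frac{1+q^n}{1+q^{2n}}\,\frac{(q/a,q/b;q)_n}{(a,b;q)_n}(-ab)^nq^{(n^2-n)/2}.$$
   Context: Notation: $(x;q)_0=1$, $(x;q)_n=\prod_{k=0}^{n-1}(1-xq^k)$, $(x;q)_\infty=\prod_{k=0}^\infty(1-xq^k)$, $(x_1,\dots,x_k;q)_n=(x_1;q)_n\cdots(x_k;q)_n$ (also for $n=\infty$), and $${}_3\phi_2\left(\begin{matrix}A_1,A_2,A_3\\ B_1,B_2\end{matrix};q,z\right)=\sum_{n=0}^\infty\frac{(A_1,A_2,A_3;q)_n}{(q,B_1,B_2;q)_n}z^n .$$ *)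

(* Defs.v *)
From Stdlib Require Import Reals Lra Lia.
From Coquelicot Require Import Coquelicot.

Open Scope C_scope.

(** The [q]-shifted factorial [(x;q)_n]. *)
Fixpoint qpoch (x q : C) (n : nat) : C :=
  match n with
  | O => 1
  | S k => qpoch x q k * (1 - x * q ^ k)
  end.

(** [(x;q)_oo].  Like Coquelicot's [RInt], this is a total function, which is
    meaningful when the limit exists; see [qpoch_inf_correct]. *)
Definition qpoch_inf (x q : C) : C :=
  iota (T := C_CompleteNormedModule)
    (fun l : C => filterlim (qpoch x q) eventually (locally l)).

(** Coquelicot's [Series] is restricted to real terms; this is the complex
    analogue, meaningful when [ex_series u]; see [CSeries_correct]. *)
Definition CSeries (u : nat -> C) : C :=
  iota (T := C_CompleteNormedModule) (fun l : C => is_series u l).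

Definition phi32_term (A1 A2 A3 B1 B2 q z : C) (n : nat) : C :=
  (qpoch A1 q n * qpoch A2 q n * qpoch A3 q n) /
  (qpoch q q n * qpoch B1 q n * qpoch B2 q n) * z ^ n.

Definition phi32 (A1 A2 A3 B1 B2 q z : C) : C :=
  CSeries (phi32_term A1 A2 A3 B1 B2 q z).

Lemma CSeries_unique (u : nat -> C) (l : C) : is_series u l -> CSeries u = l.
Proof.
intros H. unfold CSeries.
exact (iota_filterlim_locally (V := C_CompleteNormedModule) (sum_n u) l H).
Qed.

Lemma CSeries_correct (u : nat -> C) : ex_series u -> is_series u (CSeries u).
Proof. intros [l H]. now rewrite (CSeries_unique _ _ H). Qed.

Lemma qpoch_bound (x q : C) (n : nat) :
  (Cmod q < 1 ->
  Cmod (qpoch x q n) <= exp (Cmod x * ((1 - Cmod q ^ n) / (1 - Cmod q))))%R.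
Proof.
intros Hq. induction n as [|n IH].
- simpl. rewrite Cmod_1. replace (_ * _)%R with 0%R by (field; lra).
  rewrite exp_0. lra.
- simpl qpoch. rewrite Cmod_mult.
  replace (Cmod x * ((1 - Cmod q ^ S n) / (1 - Cmod q)))%R
    with (Cmod x * ((1 - Cmod q ^ n) / (1 - Cmod q)) + Cmod x * Cmod q ^ n)%R
    by (simpl; field; lra).
  rewrite exp_plus.
  apply Rmult_le_compat; try apply Cmod_ge_0; auto.
  eapply Rle_trans; [apply Cmod_triangle|].
  rewrite Cmod_opp, Cmod_mult, Cmod_pow, Cmod_1.
  apply exp_ineq1_le.
Qed.

Lemma qpoch_cvg (x q : C) :
  (Cmod q < 1)%R ->
  exists l : C, filterlim (qpoch x q) eventually (locally l).
Proof.
intros Hq.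
set (d := fun n => qpoch x q n * (- (x * q ^ n))).
assert (Hd : ex_series d).
{ apply (ex_series_le (V := C_CompleteNormedModule) d
    (fun n => exp (Cmod x / (1 - Cmod q)) * Cmod x * Cmod q ^ n)%R).
  - intros n. unfold d. change (norm ?z) with (Cmod z).
    rewrite Cmod_mult, Cmod_opp, Cmod_mult, Cmod_pow, Rmult_assoc.
    apply Rmult_le_compat_r.
    { apply Rmult_le_pos; [apply Cmod_ge_0|apply pow_le, Cmod_ge_0]. }
    eapply Rle_trans; [apply qpoch_bound; exact Hq|].
    assert (H : (Cmod x * ((1 - Cmod q ^ n) / (1 - Cmod q))
                 <= Cmod x / (1 - Cmod q))%R).
    { unfold Rdiv. apply Rmult_le_compat_l; [apply Cmod_ge_0|].
      rewrite <- (Rmult_1_l (/ _)) at 2.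
      apply Rmult_le_compat_r; [left; apply Rinv_0_lt_compat; lra|].
      assert (0 <= Cmod q ^ n)%R by apply pow_le, Cmod_ge_0. lra. }
    destruct H as [H|H]; [left; now apply exp_increasing|rewrite H; lra].
  - apply (ex_series_scal_l (V := R_NormedModule)).
    apply ex_series_geom. rewrite Rabs_pos_eq; [exact Hq|apply Cmod_ge_0]. }
destruct Hd as [l Hl]. exists (1 + l).
assert (Hs : forall n, qpoch x q (S n) = 1 + sum_n d n).
{ induction n as [|n IH].
  - rewrite sum_O. unfold d. simpl. ring.
  - rewrite sum_Sn. change (plus ?y ?z) with (y + z).
    rewrite Cplus_assoc, <- IH. unfold d. simpl. ring. }
assert (Hlim : filterlim (fun n => qpoch x q (S n)) eventually (locally (1 + l))).
{ apply (filterlim_ext (fun n => plus (1 : C) (sum_n d n))).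
  - intros n. now rewrite Hs.
  - apply (filterlim_comp_2 (G := locally (1 : C)) (H := locally l)).
    + apply filterlim_const.
    + exact Hl.
    + apply (filterlim_plus (V := C_NormedModule)). }
intros P HP. destruct (Hlim P HP) as [N HN]. exists (S N).
intros [|n] Hn; [lia|]. apply HN. lia.
Qed.

Lemma qpoch_inf_unique (x q l : C) :
  filterlim (qpoch x q) eventually (locally l) -> qpoch_inf x q = l.
Proof.
intros H. unfold qpoch_inf.
exact (iota_filterlim_locally (V := C_CompleteNormedModule) (qpoch x q) l H).
Qed.

Lemma qpoch_inf_correct (x q : C) :
  (Cmod q < 1)%R ->
  filterlim (qpoch x q) eventually (locally (qpoch_inf x q)).
Proof.
intros Hq. destruct (qpoch_cvg x q Hq) as [l Hl].
now rewrite (qpoch_inf_unique _ _ _ Hl).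
Qed.

(* Main.v *)
(* This is Bailey's lemma relative to [1], with [rho1 = q/a] and [rho2 = q/b], applied to the
   Bailey pair [beta_n = 1/(-q^2;q^2)_n], [alpha_n = 2 (-1)^n q^(n(n+1)/2) (1+q^n)/(1+q^(2n))]
   ([alpha_0 = 1]).  That this is a Bailey pair follows from the recurrence
   [(1+q^(2n+2)) beta_(n+1) = beta_n]: the factor [1+q^(2r)] that it produces cancels the
   denominator of [alpha_r], and the remaining sum telescopes.  Bailey's lemma is proved in its
   finite form, where exchanging the two sums is harmless and the inner sum is evaluated by the
   q-Pfaff-Saalschuetz formula; Tannery's theorem then gives the limit on both sides. *)

Require Import Defs.
From Stdlib Require Import Reals Lra Lia.
From Coquelicot Require Import Coquelicot.

Open Scope C_scope.

(* [sum_n] types equations in a canonical structure, which hides [C] from [ring] and [field]. *)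
Ltac as_C := match goal with |- ?x = ?y => change (@eq C x y) end.

(** * Finite complex sums and exchange of summation *)

Lemma Csum_O (u : nat -> C) : sum_n u 0 = u O.
Proof. exact (sum_O u). Qed.

Lemma Csum_S (u : nat -> C) (n : nat) : sum_n u (S n) = sum_n u n + u (S n).
Proof. exact (sum_Sn u n). Qed.

Lemma Csum_mult_l (c : C) (u : nat -> C) (n : nat) :
  sum_n (fun k => c * u k) n = c * sum_n u n.
Proof. exact (sum_n_mult_l (K := C_Ring) c u n). Qed.

Lemma Csum_mult_r (c : C) (u : nat -> C) (n : nat) :
  sum_n (fun k => u k * c) n = sum_n u n * c.
Proof. exact (sum_n_mult_r (K := C_Ring) c u n). Qed.

Lemma Csum_plus (u v : nat -> C) (n : nat) :
  sum_n (fun k => u k + v k) n = sum_n u n + sum_n v n.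
Proof. exact (sum_n_plus u v n). Qed.

Lemma Csum_ext (u v : nat -> C) (n : nat) :
  (forall k, (k <= n)%nat -> u k = v k) -> sum_n u n = sum_n v n.
Proof. exact (sum_n_ext_loc u v n). Qed.

(** The summation region is [r <= n <= N], with [n = r + m]. Raising [N] by one adds a full row on
    the left; on the right it adds one term to each inner sum and a new one-term sum at
    [r = N + 1]. *)
Lemma Csum_triangle_switch (u : nat -> nat -> C) (N : nat) :
  sum_n (fun n => sum_n (u n) n) N =
  sum_n (fun r => sum_n (fun m => u (r + m)%nat r) (N - r)) N.
Proof.
induction N as [|N IH].
- now rewrite !Csum_O.
- rewrite Csum_S, IH, (Csum_S (fun r => sum_n _ _)), Nat.sub_diag, Csum_O,
    Nat.add_0_r, Csum_S, Cplus_assoc, <- Csum_plus.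
  f_equal. apply Csum_ext. intros r Hr.
  rewrite Nat.sub_succ_l, Csum_S by exact Hr.
  do 2 f_equal. lia.
Qed.

(** * Algebra and nonvanishing of q-shifted factorials *)

Lemma qpoch_S (x q : C) (n : nat) :
  qpoch x q (S n) = qpoch x q n * (1 - x * q ^ n).
Proof. reflexivity. Qed.

Lemma qpoch_add (x q : C) (m n : nat) :
  qpoch x q (m + n) = qpoch x q m * qpoch (x * q ^ m) q n.
Proof.
induction n as [|n IH].
- rewrite Nat.add_0_r. simpl. ring.
- rewrite Nat.add_succ_r, !qpoch_S, IH, Cpow_add_r. ring.
Qed.

Lemma one_minus_neq_0 (x : C) : (Cmod x < 1)%R -> 1 - x <> 0.
Proof.
intros Hx H. assert (E : x = 1) by (replace x with (1 - (1 - x)) by ring; rewrite H; ring).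
rewrite E, Cmod_1 in Hx. lra.
Qed.

Lemma one_plus_neq_0 (x : C) : (Cmod x < 1)%R -> 1 + x <> 0.
Proof.
intros Hx. replace (1 + x) with (1 - - x) by ring.
apply one_minus_neq_0. now rewrite Cmod_opp.
Qed.

Lemma Cmod_pow_le_1 (q : C) (n : nat) : (Cmod q < 1 -> Cmod (q ^ n) <= 1)%R.
Proof.
intros Hq. rewrite Cmod_pow, <- (pow1 n). apply pow_incr.
split; [apply Cmod_ge_0|lra].
Qed.

Lemma Cmod_pow_S_lt_1 (q : C) (n : nat) : (Cmod q < 1 -> Cmod (q ^ S n) < 1)%R.
Proof.
intros Hq. rewrite Cpow_S, Cmod_mult.
pose proof (Cmod_pow_le_1 q n Hq). pose proof (Cmod_ge_0 q).
pose proof (Cmod_ge_0 (q ^ n)). nra.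
Qed.

Lemma Cmod_mult_pow_lt_1 (x q : C) (n : nat) :
  (Cmod q < 1 -> Cmod x < 1 -> Cmod (x * q ^ n) < 1)%R.
Proof.
intros Hq Hx. rewrite Cmod_mult.
pose proof (Cmod_pow_le_1 q n Hq). pose proof (Cmod_ge_0 x).
pose proof (Cmod_ge_0 (q ^ n)). nra.
Qed.

Lemma qpoch_neq_0 (x q : C) (n : nat) :
  (Cmod q < 1)%R -> (Cmod x < 1)%R -> qpoch x q n <> 0.
Proof.
intros Hq Hx. induction n as [|n IH].
- exact C1_nz.
- rewrite qpoch_S. apply Cmult_neq_0; [exact IH|].
  now apply one_minus_neq_0, Cmod_mult_pow_lt_1.
Qed.

Lemma Clinear_solve (c s r t : C) : c <> 0 -> c * s + r = t -> s = (t - r) / c.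
Proof. intros Hc <-. now field. Qed.

(** * The q-Pfaff-Saalschuetz sum *)

(** This is (z;q)_M/(q;q)_M times the m-th term of the balanced 3phi2 with upper parameters q^(-M),
    A, B, lower parameters ABz, q^(1-M)/z and argument q. Reversing the factors with negative powers
    of q turns them into the ones indexed by [M - m]. *)
Definition saalschutz_term (q A B z : C) (M m : nat) : C :=
  qpoch A q m * qpoch B q m * z ^ m * qpoch z q (M - m) /
  (qpoch q q (M - m) * qpoch q q m * qpoch (A * B * z) q m).

Section Saalschutz.

Variables q A B z : C.
Hypothesis hq : (Cmod q < 1)%R.
Hypothesis hC : (Cmod (A * B * z) < 1)%R.

Local Notation F := (saalschutz_term q A B z).
(* Wilf-Zeilberger: the sum over [m] satisfies a first-order recurrence in [M], and the
   right-hand side is the certificate; at [K = M] it is minus the missing term [m = M + 1]. *)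
Lemma saalschutz_telescope (M K : nat) : (K <= M)%nat ->
  sum_n (fun m => (1 - q ^ S M) * (1 - A * B * z * q ^ M) * F (S M) m -
                  (1 - A * z * q ^ M) * (1 - B * z * q ^ M) * F M m) K =
  - q ^ (M - K) * (qpoch A q (S K) * qpoch B q (S K) * qpoch z q (M - K) * z ^ S K) /
    (qpoch q q (M - K) * qpoch q q K * qpoch (A * B * z) q K).
Proof.
assert (Hstep : forall k d, qpoch q q d <> 0 /\ 1 - q * q ^ d <> 0 /\ qpoch q q k <> 0
   /\ 1 - q * q ^ k <> 0 /\ qpoch (A * B * z) q k <> 0 /\ 1 - A * B * z * q ^ k <> 0).
{ intros k d. rewrite <- !Cpow_S.
  repeat split; try (now apply qpoch_neq_0);
   apply one_minus_neq_0; try (now apply Cmod_pow_S_lt_1);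
   now apply Cmod_mult_pow_lt_1. }
induction K as [|K IH]; intros HK.
- rewrite Csum_O. unfold saalschutz_term. rewrite !Nat.sub_0_r, !qpoch_S, !Cpow_S.
  destruct (Hstep O M) as (? & ? & _). simpl qpoch. simpl (_ ^ 0).
  as_C; field. repeat split; auto using C1_nz.
- rewrite Csum_S, IH by lia. unfold saalschutz_term.
  rewrite (Nat.sub_succ_l (S K)) by lia.
  replace (M - K)%nat with (S (M - S K)) by lia.
  (* Writing [M = S K + d] removes truncated subtraction, so that [field] sees powers of q with
     independent exponents. *)
  set (d := (M - S K)%nat).
  replace M with (S K + d)%nat by (unfold d; lia).
  destruct (Hstep K d) as (? & ? & ? & ? & ? & ?).
  rewrite !qpoch_S, !Cpow_S, Cpow_add_r, !Cpow_S.
  as_C; field. repeat split; auto.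
Qed.

(** Telescoping up to [K = M] gives a recurrence for the sum, except that the term [m = M + 1] is
    missing; adding it cancels the certificate. What is left is the first-order recurrence of the
    product on the right. *)
Lemma saalschutz (M : nat) :
  sum_n (F M) M =
  qpoch (A * z) q M * qpoch (B * z) q M / (qpoch q q M * qpoch (A * B * z) q M).
Proof.
induction M as [|M IH].
- rewrite Csum_O. unfold saalschutz_term. simpl. as_C; field.
- pose proof (saalschutz_telescope M M (le_n M)) as T.
  rewrite Nat.sub_diag in T.
  assert (h1 : 1 - q * q ^ M <> 0)
    by (rewrite <- Cpow_S; now apply one_minus_neq_0, Cmod_pow_S_lt_1).
  assert (h2 : 1 - A * B * z * q ^ M <> 0)
    by now apply one_minus_neq_0, Cmod_mult_pow_lt_1.
  assert (h3 : qpoch q q M <> 0) by now apply qpoch_neq_0.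
  assert (h4 : qpoch (A * B * z) q M <> 0) by now apply qpoch_neq_0.
  rewrite (Csum_ext _ (fun m => (1 - q ^ S M) * (1 - A * B * z * q ^ M) * F (S M) m +
     - ((1 - A * z * q ^ M) * (1 - B * z * q ^ M)) * F M m)) in T
    by (intros; as_C; ring).
  rewrite Csum_plus, !Csum_mult_l, IH in T.
  rewrite Csum_S.
  apply Clinear_solve in T; [|apply Cmult_neq_0; [rewrite Cpow_S|]; assumption].
  rewrite T. unfold saalschutz_term. rewrite Nat.sub_diag, !qpoch_S, !Cpow_S.
  simpl (qpoch _ q 0). simpl (q ^ 0). as_C; field. repeat split; auto using C1_nz.
Qed.

End Saalschutz.

(** * The Bailey pair *)

(* [alpha_n/((q;q)_(N-n) (q;q)_(N+n))] with [n > 0] collects the indices [n] and [-n] of a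
   bilateral sum, whence the factor 2 and the exception at 0. *)
Definition alpha (q : C) (n : nat) : C :=
  match n with
  | O => 1
  | S _ => 2 * (- (1)) ^ n * q ^ n * q ^ ((n ^ 2 - n) / 2) * ((1 + q ^ n) / (1 + q ^ (2 * n)))
  end.

Lemma triangular_S (n : nat) :
  ((S n ^ 2 - S n) / 2 = (n ^ 2 - n) / 2 + n)%nat.
Proof.
replace (S n ^ 2 - S n)%nat with ((n ^ 2 - n) + n * 2)%nat.
- apply Nat.div_add. lia.
- simpl. nia.
Qed.

(** Once [1 + q ^ (2 * r)] cancels the denominator of [alpha q r], each summand is the difference of
    two consecutive values of the right-hand side. At [r = 0] this factor equals 2 and supplies the
    2 that [alpha q 0] lacks. The bound [R < N] keeps [N - S R] from truncating. *)
Lemma alpha_telescope (q : C) (N R : nat) : (Cmod q < 1)%R -> (R < N)%nat ->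
  sum_n (fun r => alpha q r * q ^ (N - r) * (1 + q ^ (2 * r)) /
                  (qpoch q q (N - r) * qpoch q q (N + r))) R =
  2 * (- (1)) ^ R * q ^ N * q ^ ((S R ^ 2 - S R) / 2) /
    (qpoch q q (N - S R) * qpoch q q (N + R) * (1 - q ^ N)).
Proof.
intros hq.
assert (h : forall n, qpoch q q n <> 0) by (intros; now apply qpoch_neq_0).
assert (h1 : forall n, 1 - q * q ^ n <> 0)
    by (intros; rewrite <- Cpow_S; now apply one_minus_neq_0, Cmod_pow_S_lt_1).
induction R as [|R IH]; intros HR.
- destruct N as [|N]; [lia|].
  rewrite Csum_O, Nat.sub_0_r, Nat.add_0_r. simpl (S N - 1)%nat. rewrite Nat.sub_0_r.
  rewrite qpoch_S. simpl. as_C; field. auto using C1_nz.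
- rewrite Csum_S, IH by lia. rewrite (triangular_S (S R)), !Cpow_add_r.
  replace (N - S R)%nat with (S (N - S (S R))) by lia.
  set (d := (N - S (S R))%nat).
  replace N with (S (S R) + d)%nat by (unfold d; lia).
  rewrite Nat.add_succ_r, !qpoch_S, <- !Cpow_S. unfold alpha.
  assert (h2 : 1 + q ^ (2 * S R) <> 0).
  { replace (2 * S R)%nat with (S (S (2 * R)))%nat by lia.
    now apply one_plus_neq_0, Cmod_pow_S_lt_1. }
  pose proof (h d); pose proof (h (S (S R) + d + R)%nat). pose proof (h1 d).
  pose proof (h1 (S R + d)%nat) as h3. pose proof (h1 (S (S R) + d + R)%nat) as h4.
  set (X := qpoch q q (S (S R) + d + R)) in *. 
  revert h2 h3 h4. replace (2 * S R)%nat with (S R + S R)%nat by lia.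
  repeat rewrite ?Cpow_S, ?Cpow_add_r. intros.
  as_C; field. repeat split; auto.
  intros E. apply h3. rewrite <- E. ring.
Qed.

(** The telescoped sum over [r <= n] is minus the remaining term [r = n + 1]. The index [S n]
    matters: for index 0 the sum would be 2. *)
Lemma alpha_balance (q : C) (n : nat) : (Cmod q < 1)%R ->
  sum_n (fun r => alpha q r * q ^ (S n - r) * (1 + q ^ (2 * r)) /
                  (qpoch q q (S n - r) * qpoch q q (S n + r))) (S n) = RtoC 0.
Proof.
intros hq. rewrite Csum_S, alpha_telescope by (assumption || lia).
rewrite Nat.sub_diag, Nat.add_succ_r, qpoch_S, <- Cpow_S. unfold alpha.
assert (h2 : 1 + q ^ (2 * S n) <> 0).
{ replace (2 * S n)%nat with (S (S (2 * n)))%nat by lia.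
  now apply one_plus_neq_0, Cmod_pow_S_lt_1. }
pose proof (one_plus_neq_0 _ (Cmod_pow_S_lt_1 q n hq)) as h3.
pose proof (one_minus_neq_0 _ (Cmod_pow_S_lt_1 q n hq)) as h4.
pose proof (one_minus_neq_0 _ (Cmod_pow_S_lt_1 q (S n + n) hq)) as h5.
pose proof (qpoch_neq_0 q q (S n + n) hq hq) as h6.
revert h5 h6 h2. replace (S (S n + n)) with (S n + S n)%nat by lia.
replace (2 * S n)%nat with (S n + S n)%nat by lia.
set (X := qpoch q q (S n + n)). set (T := ((S n ^ 2 - S n) / 2)%nat).
rewrite (Cpow_add_r q (S n)). simpl (qpoch _ _ 0). simpl (q ^ 0).
rewrite (Cpow_S (- (1))). set (Q := q ^ S n) in *. intros h5 h6 h2.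
as_C. field. repeat split; auto.
Qed.

(** Since i^2 = -1, the two new factors multiply to 1 + q^(2n+2); hence the product is (-q^2;q^2)_n,
    the reciprocal of beta_n. *)
Lemma qpoch_Ci (q : C) (n : nat) :
  qpoch (Ci * q) q (S n) * qpoch (- (Ci * q)) q (S n) =
  qpoch (Ci * q) q n * qpoch (- (Ci * q)) q n * (1 + q ^ (2 * S n)).
Proof.
rewrite !qpoch_S. replace (2 * S n)%nat with (S n + S n)%nat by lia.
rewrite Cpow_add_r, !Cpow_S.
assert (H : Ci * Ci = - (1)) by (apply injective_projections; simpl; ring).
set (Q := q ^ n).
transitivity (qpoch (Ci * q) q n * qpoch (- (Ci * q)) q n *
  (1 - (Ci * Ci) * (q * Q * (q * Q)))); [ring|rewrite H; ring].
Qed.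

(** With N = n + 1, the identity 1 + q^(2N) - (1 - q^(N-r))(1 - q^(N+r)) = q^(N-r) (1 + q^(2r))
    turns [alpha_balance] into (1 + q^(2N)) beta_N = beta_(N-1), which the right-hand side satisfies
    by [qpoch_Ci]. *)
Lemma bailey_pair (q : C) (n : nat) : (Cmod q < 1)%R ->
  sum_n (fun r => alpha q r / (qpoch q q (n - r) * qpoch q q (n + r))) n =
  / (qpoch (Ci * q) q n * qpoch (- (Ci * q)) q n).
Proof.
intros hq.
assert (h : forall n, qpoch q q n <> 0) by (intros; now apply qpoch_neq_0).
assert (h1 : forall n, 1 - q * q ^ n <> 0)
    by (intros; rewrite <- Cpow_S; now apply one_minus_neq_0, Cmod_pow_S_lt_1).
induction n as [|n IH].
- rewrite Csum_O. simpl. as_C. field.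
- assert (h2 : 1 + q ^ (2 * S n) <> 0).
  { replace (2 * S n)%nat with (S (S (2 * n)))%nat by lia.
    now apply one_plus_neq_0, Cmod_pow_S_lt_1. }
  rewrite qpoch_Ci.
  replace (/ (qpoch (Ci * q) q n * qpoch (- (Ci * q)) q n * (1 + q ^ (2 * S n))))
    with (/ (qpoch (Ci * q) q n * qpoch (- (Ci * q)) q n) * / (1 + q ^ (2 * S n))).
  2:{ field. repeat split; try assumption; apply qpoch_neq_0; try assumption;
      rewrite ?Cmod_opp, Cmod_mult, Cmod_Ci, Rmult_1_l; exact hq. }
  rewrite <- IH.
  (* The term [r = n + 1] is set apart: it has no counterpart in the sum for [n], where [n - r]
     would truncate. *)
  pose proof (alpha_balance q n hq) as T. rewrite Csum_S in T.
  rewrite (Csum_ext _ (fun r =>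
    (1 + q ^ (2 * S n)) * (alpha q r / (qpoch q q (S n - r) * qpoch q q (S n + r))) +
    - (1) * (alpha q r / (qpoch q q (n - r) * qpoch q q (n + r))))) in T.
  + rewrite Csum_plus, !Csum_mult_l in T. rewrite Csum_S.
    set (s := sum_n (fun r => alpha q r / (qpoch q q (S n - r) * qpoch q q (S n + r))) n) in *.
    set (s' := sum_n (fun r => alpha q r / (qpoch q q (n - r) * qpoch q q (n + r))) n) in *.
    revert T. rewrite Nat.sub_diag. generalize (h (S n + S n)%nat).
    generalize (alpha q (S n)). generalize (qpoch q q (S n + S n)).
    clearbody s s'. change C in s. change C in s'.
    generalize dependent (1 + q ^ (2 * S n)). intros Y hY X al hX T.
    assert (E : s' = Y * s + al * q ^ 0 * Y / (qpoch q q 0 * X)).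
    { transitivity (s' + 0); [as_C; ring|]. rewrite <- T. as_C; ring. }
    rewrite E. simpl. as_C. field. auto.
  + intros r Hr. replace (S n - r)%nat with (S (n - r)) by lia.
    replace (S n + r)%nat with (S (n + r)) by lia. rewrite !qpoch_S.
    pose proof (h (n - r)%nat). pose proof (h (n + r)%nat).
    pose proof (h1 (n - r)%nat). pose proof (h1 (n + r)%nat) as h3.
    revert h3. set (X := qpoch q q (n + r)) in *. set (d := (n - r)%nat) in *.
    replace (2 * S n)%nat with (S (d + r) + S (d + r))%nat by (unfold d; lia).
    replace (2 * r)%nat with (r + r)%nat by lia.
    replace (n + r)%nat with (d + r + r)%nat by (unfold d; lia).
    repeat rewrite ?Cpow_S, ?Cpow_add_r. intros. as_C. field.
    auto.
Qed.

(** * Finite form of Bailey's lemma *)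

(** After the exchange of sums with n = r + m, the inner sum over m is a Saalschuetz sum with
    parameters A q^r, B q^r, z and length N - r. The sequence [al] is arbitrary; [A * B * z = q]
    expresses that the lemma is taken relative to 1. *)
Lemma finite_bailey (q A B z : C) (al : nat -> C) (N : nat) :
  (Cmod q < 1)%R -> (Cmod (A * z) < 1)%R -> (Cmod (B * z) < 1)%R -> A * B * z = q ->
  sum_n (fun n => qpoch A q n * qpoch B q n * z ^ n * (qpoch z q (N - n) / qpoch q q (N - n)) *
     sum_n (fun r => al r / (qpoch q q (n - r) * qpoch q q (n + r))) n) N =
  qpoch (A * z) q N * qpoch (B * z) q N *
  sum_n (fun r => al r * (qpoch A q r * qpoch B q r / (qpoch (A * z) q r * qpoch (B * z) q r)) *
     z ^ r * (/ qpoch q q (N - r) * / qpoch q q (N + r))) N.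
Proof.
intros hq hA hB hz.
assert (h : forall n, qpoch q q n <> 0) by (intros; now apply qpoch_neq_0).
rewrite <- Csum_mult_l.
rewrite (Csum_ext _ (fun n => sum_n (fun r => qpoch A q n * qpoch B q n * z ^ n *
   (qpoch z q (N - n) / qpoch q q (N - n)) *
   (al r / (qpoch q q (n - r) * qpoch q q (n + r)))) n))
  by (intros; symmetry; apply Csum_mult_l).
rewrite (Csum_triangle_switch (fun n r => qpoch A q n * qpoch B q n * z ^ n *
   (qpoch z q (N - n) / qpoch q q (N - n)) *
   (al r / (qpoch q q (n - r) * qpoch q q (n + r))))).
apply Csum_ext. intros r Hr.
set (M := (N - r)%nat). assert (hN : (N = r + M)%nat) by (unfold M; lia).
clearbody M. subst N.
(* The denominator parameter becomes q^(2r+1), so (q^(2r+1);q)_m extends (q;q)_(2r) to (q;q)_(2r+m),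
   which is (q;q)_(n+r). *)
assert (hC : (A * q ^ r) * (B * q ^ r) * z = q * q ^ (r + r))
  by (rewrite Cpow_add_r; transitivity (A * B * z * (q ^ r * q ^ r)); [ring|now rewrite hz]).
assert (hC1 : (Cmod (q * q ^ (r + r)) < 1)%R) by now apply Cmod_mult_pow_lt_1.
rewrite (Csum_ext _ (fun m => al r * qpoch A q r * qpoch B q r * z ^ r / qpoch q q (r + r) *
  saalschutz_term q (A * q ^ r) (B * q ^ r) z M m)).
- rewrite Csum_mult_l, saalschutz; rewrite ?hC; [|assumption..].
  replace (r + M + r)%nat with (r + r + M)%nat by lia.
  rewrite !qpoch_add.
  replace (A * q ^ r * z) with (A * z * q ^ r) by ring.
  replace (B * q ^ r * z) with (B * z * q ^ r) by ring.
  pose proof (h (r + r)%nat). pose proof (h M).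
  pose proof (qpoch_neq_0 _ q r hq hA). pose proof (qpoch_neq_0 _ q r hq hB).
  pose proof (qpoch_neq_0 _ q M hq hC1).
  as_C. rewrite <- (qpoch_add q q r r). field. auto.
- intros m Hm. unfold saalschutz_term. rewrite hC.
  replace (r + M - (r + m))%nat with (M - m)%nat by lia.
  replace (r + m - r)%nat with m by lia.
  replace (r + m + r)%nat with (r + r + m)%nat by lia.
  rewrite !qpoch_add, Cpow_add_r, <- (qpoch_add q q r r).
  pose proof (h (r + r)%nat). pose proof (h (M - m)%nat). pose proof (h m).
  pose proof (qpoch_neq_0 _ q m hq hC1).
  as_C. field. auto.
Qed.

(** * Limits of complex sequences *)

(** Convergence is stated through the real sequence of distances, so that squeezing and limit rules
    for real sequences apply. *)
Definition Clim (u : nat -> C) (l : C) : Prop :=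
  is_lim_seq (fun n => Cmod (u n - l)) 0%R.

Lemma Clim_filterlim (u : nat -> C) (l : C) :
  Clim u l <-> filterlim u eventually (locally (l : C_NormedModule)).
Proof.
unfold Clim. rewrite <- is_lim_seq_spec.
rewrite (filterlim_locally_ball_norm (U := C_NormedModule)).
split; intros H eps; destruct (H eps) as [N HN]; exists N; intros n Hn;
  specialize (HN n Hn).
- change (Cmod (u n - l) < eps)%R.
  rewrite Rminus_0_r, Rabs_pos_eq in HN by apply Cmod_ge_0. exact HN.
- rewrite Rminus_0_r, Rabs_pos_eq by apply Cmod_ge_0. exact HN.
Qed.

Lemma Clim_unique (u : nat -> C) (l m : C) : Clim u l -> Clim u m -> l = m.
Proof.
rewrite !Clim_filterlim. apply (filterlim_locally_unique (V := C_NormedModule)).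
Qed.

Lemma Clim_ext (u v : nat -> C) (l : C) : (forall n, u n = v n) -> Clim u l -> Clim v l.
Proof. intros H. apply is_lim_seq_ext. intros n. now rewrite H. Qed.

Lemma Clim_const (c : C) : Clim (fun _ => c) c.
Proof.
apply (is_lim_seq_ext (fun _ => 0%R)); [|apply is_lim_seq_const].
intros _. replace (c - c) with (RtoC 0) by ring. now rewrite Cmod_0.
Qed.

Lemma Clim_subseq (u : nat -> C) (l : C) (phi : nat -> nat) :
  filterlim phi eventually eventually -> Clim u l -> Clim (fun n => u (phi n)) l.
Proof. exact (is_lim_seq_subseq (fun n => Cmod (u n - l)) 0%R phi). Qed.

Lemma Clim_squeeze (u : nat -> C) (l : C) (e : nat -> R) :
  (forall n, (Cmod (u n - l) <= e n)%R) -> is_lim_seq e 0%R -> Clim u l.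
Proof.
intros H He. apply (is_lim_seq_le_le (fun _ => 0%R) _ e); auto using is_lim_seq_const.
intros n. split; [apply Cmod_ge_0|apply H].
Qed.

Lemma Clim_plus (u v : nat -> C) (l m : C) :
  Clim u l -> Clim v m -> Clim (fun n => u n + v n) (l + m).
Proof.
intros Hu Hv.
apply (Clim_squeeze _ _ (fun n => Cmod (u n - l) + Cmod (v n - m))%R).
- intros n. replace (u n + v n - (l + m)) with ((u n - l) + (v n - m)) by ring.
  apply Cmod_triangle.
- rewrite <- (Rplus_0_r 0). now apply is_lim_seq_plus'.
Qed.

Lemma Clim_mult (u v : nat -> C) (l m : C) :
  Clim u l -> Clim v m -> Clim (fun n => u n * v n) (l * m).
Proof.
intros Hu Hv.
apply (Clim_squeeze _ _ (fun n => Cmod (u n - l) * Cmod (v n - m) +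
  (Cmod l * Cmod (v n - m) + Cmod m * Cmod (u n - l)))%R).
- intros n.
  replace (u n * v n - l * m) with
    ((u n - l) * (v n - m) + (l * (v n - m) + m * (u n - l))) by ring.
  rewrite <- !Cmod_mult.
  eapply Rle_trans; [apply Cmod_triangle|]. apply Rplus_le_compat_l, Cmod_triangle.
- replace 0%R with (0 * 0 + (Cmod l * 0 + Cmod m * 0))%R by ring.
  apply is_lim_seq_plus'; [now apply is_lim_seq_mult'|].
  apply is_lim_seq_plus'; apply is_lim_seq_mult'; auto using is_lim_seq_const.
Qed.

Lemma Clim_Cmod_le (u : nat -> C) (l : C) (K : R) :
  (forall n, (Cmod (u n) <= K)%R) -> Clim u l -> (Cmod l <= K)%R.
Proof.
intros HK Hu.
assert (H : Rbar_le (Cmod l) (K + 0)%R).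
{ apply (is_lim_seq_le (fun _ => Cmod l) (fun n => K + Cmod (u n - l))%R).
  - intros n. replace l with (u n + - (u n - l)) at 1 by ring.
    eapply Rle_trans; [apply Cmod_triangle|]. rewrite Cmod_opp.
    specialize (HK n). lra.
  - apply is_lim_seq_const.
  - apply is_lim_seq_plus'; [apply is_lim_seq_const|exact Hu]. }
simpl in H. lra.
Qed.

Definition bounded (u : nat -> C) : Prop := exists K : R, forall n, (Cmod (u n) <= K)%R.

Lemma bounded_mult (u v : nat -> C) :
  bounded u -> bounded v -> bounded (fun n => u n * v n).
Proof.
intros [K HK] [L HL]. exists (K * L)%R. intros n. rewrite Cmod_mult.
apply Rmult_le_compat; auto using Cmod_ge_0.
Qed.

(** If the limit were 0, bounded inverses would force the constant 1 = u_n / u_n to tend to 0. This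
    is how the infinite products in denominators are shown to be nonzero. *)
Lemma Clim_inv (u : nat -> C) (l : C) :
  (forall n, u n <> 0) -> bounded (fun n => / u n) -> Clim u l ->
  l <> 0 /\ Clim (fun n => / u n) (/ l).
Proof.
intros Hu [K HK] Hl.
assert (l0 : l <> 0).
{ intros ->.
  assert (HC : Clim (fun n => u n * / u n) 0).
  { apply (Clim_squeeze _ _ (fun n => K * Cmod (u n - 0))%R).
    - intros n. replace (u n * / u n - 0) with (/ u n * (u n - 0)) by ring.
      rewrite Cmod_mult. apply Rmult_le_compat_r; auto using Cmod_ge_0.
    - pose proof (is_lim_seq_mult' _ _ K 0 (is_lim_seq_const K) Hl) as H.
      now rewrite Rmult_0_r in H. }
  apply C1_nz. apply (Clim_unique (fun _ => 1)); [apply Clim_const|].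
  apply (Clim_ext (fun n => u n * / u n)); [intros n; now field|exact HC]. }
split; [exact l0|].
apply (Clim_squeeze _ _ (fun n => (K * Cmod (/ l)) * Cmod (u n - l))%R).
- intros n. replace (/ u n - / l) with (- (/ u n * / l * (u n - l))) by (field; auto).
  rewrite Cmod_opp, !Cmod_mult.
  apply Rmult_le_compat_r; [apply Cmod_ge_0|].
  apply Rmult_le_compat_r; auto using Cmod_ge_0.
- rewrite <- (Rmult_0_r (K * Cmod (/ l))).
  apply is_lim_seq_mult'; [apply is_lim_seq_const|exact Hl].
Qed.

Lemma Clim_sum (f : nat -> nat -> C) (g : nat -> C) (K : nat) :
  (forall n, Clim (fun N => f N n) (g n)) ->
  Clim (fun N => sum_n (f N) K) (sum_n g K).
Proof.
intros H. induction K as [|K IH].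
- apply (Clim_ext (fun N => f N O)); [intros; now rewrite Csum_O|].
  rewrite Csum_O. apply H.
- apply (Clim_ext (fun N => sum_n (f N) K + f N (S K))); [intros; now rewrite Csum_S|].
  rewrite Csum_S. now apply Clim_plus.
Qed.

(** * Tannery's theorem *)

(** The bound with w^K - w^(K+d) in place of w^K is the one that passes through induction on [d].
    Domination is asked only up to [K + d], because in [tannery] the row [f N] is dominated only for
    [n <= N]. *)
Lemma geometric_tail (u : nat -> C) (M w : R) (K d : nat) :
  (0 <= w < 1)%R -> (0 <= M)%R ->
  (forall n, (n <= K + d)%nat -> (Cmod (u n) <= M * w ^ n)%R) ->
  (Cmod (sum_n u (K + d)%nat - sum_n u K) <= M / (1 - w) * w ^ K)%R.
Proof.
intros Hw HM Hu.
enough (H : (Cmod (sum_n u (K + d)%nat - sum_n u K) <= M / (1 - w) * (w ^ K - w ^ (K + d)))%R).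
{ eapply Rle_trans; [exact H|]. apply Rmult_le_compat_l.
  - apply Rdiv_le_0_compat; lra.
  - assert (0 <= w ^ (K + d))%R by (apply pow_le; lra). lra. }
induction d as [|d IH].
- rewrite Nat.add_0_r. replace (sum_n u K - sum_n u K) with (RtoC 0) by (symmetry; apply Cplus_opp_r).
  rewrite Cmod_0. right. ring.
- rewrite Nat.add_succ_r, Csum_S.
  assert (Hs : (Cmod (sum_n u (K + d)%nat - sum_n u K) <= M / (1 - w) * (w ^ K - w ^ (K + d)))%R)
    by (apply IH; intros n Hn; apply Hu; lia).
  revert Hs. generalize (sum_n u (K + d)) (sum_n u K). intros s s' H1.
  change C in s, s'.
  replace (s + u (S (K + d)) - s') with ((s - s') + u (S (K + d))) by ring.
  eapply Rle_trans; [apply Cmod_triangle|].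
  assert (H2 : (Cmod (u (S (K + d))) <= M * w ^ S (K + d))%R) by (apply Hu; lia).
  assert (H3 : (M * w ^ S (K + d) <= M * w ^ (K + d))%R).
  { simpl. assert (0 <= w ^ (K + d))%R by (apply pow_le; lra).
    apply Rmult_le_compat_l; [lra|nra]. }
  replace (M / (1 - w) * (w ^ K - w ^ S (K + d)))%R with
    (M / (1 - w) * (w ^ K - w ^ (K + d)) + M * w ^ (K + d))%R
    by (simpl; field; lra).
  lra.
Qed.

(** The two partial sums up to N differ by a head of fixed length K, which tends to 0 termwise, and
    by two tails that are uniformly small in N. *)
Lemma tannery (f : nat -> nat -> C) (g : nat -> C) (M w : R) :
  (0 <= w < 1)%R -> (0 <= M)%R ->
  (forall N n, (n <= N)%nat -> (Cmod (f N n) <= M * w ^ n)%R) ->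
  (forall n, (Cmod (g n) <= M * w ^ n)%R) ->
  (forall n, Clim (fun N => f N n) (g n)) ->
  exists l, is_series g l /\ Clim (fun N => sum_n (f N) N) l.
Proof.
intros Hw HM Hf Hg Hlim.
assert (Hex : ex_series (V := C_CompleteNormedModule) g).
{ apply (ex_series_le (V := C_CompleteNormedModule) g (fun n => M * w ^ n)%R).
  - exact Hg.
  - apply (ex_series_scal_l (V := R_NormedModule)), ex_series_geom.
    rewrite Rabs_pos_eq; lra. }
destruct Hex as [l Hl]. exists l. split; [exact Hl|].
assert (Hd : Clim (fun N => sum_n (f N) N - sum_n g N) 0).
{ apply is_lim_seq_spec. intros eps.
  (* The factor 2 covers both tails at once: together they stay below eps/2, and the head takes the
     other half. *)
  assert (Hgeom : is_lim_seq (fun K => 2 * (M / (1 - w)) * w ^ K)%R 0%R).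
  { rewrite <- (Rmult_0_r (2 * (M / (1 - w)))).
    apply is_lim_seq_mult'; [apply is_lim_seq_const|].
    apply is_lim_seq_geom. rewrite Rabs_pos_eq; lra. }
  apply is_lim_seq_spec in Hgeom.
  destruct (Hgeom (pos_div_2 eps)) as [K HK]. specialize (HK K (le_n K)).
  pose proof (Clim_sum f g K Hlim) as HS. apply is_lim_seq_spec in HS.
  destruct (HS (pos_div_2 eps)) as [N0 HN0].
  exists (Nat.max N0 K). intros N HN. specialize (HN0 N ltac:(lia)).
  rewrite Rminus_0_r, Rabs_pos_eq in HN0 by apply Cmod_ge_0.
  rewrite Rminus_0_r, Rabs_pos_eq by apply Cmod_ge_0.
  apply Rabs_def2 in HK. simpl in HK, HN0.
  replace N with (K + (N - K))%nat in * by lia. set (d := (N - K)%nat) in *.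
  pose proof (geometric_tail (f (K + d)%nat) M w K d Hw HM ltac:(intros; now apply Hf)) as H1.
  pose proof (geometric_tail g M w K d Hw HM ltac:(intros; now apply Hg)) as H2.
  revert HN0 H1 H2.
  generalize (sum_n (f (K + d)%nat) (K + d)%nat : C) (sum_n (f (K + d)%nat) K : C)
    (sum_n g (K + d)%nat : C) (sum_n g K : C).
  intros s1 s2 s3 s4 h1 h2 h3. change C in s1, s2, s3, s4.
  replace (s1 - s3 - 0) with ((s1 - s2) + ((s2 - s4) + - (s3 - s4))) by ring.
  eapply Rle_lt_trans; [apply Cmod_triangle|].
  eapply Rle_lt_trans; [apply Rplus_le_compat_l, Cmod_triangle|].
  rewrite Cmod_opp. lra. }
apply (Clim_ext (fun N => (sum_n (f N) N - sum_n g N) + sum_n g N)).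
- intros N. generalize (sum_n (f N) N) (sum_n g N). intros x y. change C in x, y. ring.
- replace l with (0 + l) by ring. apply Clim_plus; [exact Hd|].
  now apply Clim_filterlim.
Qed.

(** Both sides of the finite Bailey lemma have this shape. The bounds on c, d and e give a
    dominating multiple of |z|^n, while d and e tend to their limits for each fixed n. *)
Lemma tannery_product (c d e : nat -> C) (z D E : C) : (Cmod z < 1)%R ->
  bounded c -> bounded d -> bounded e -> Clim d D -> Clim e E ->
  exists l, is_series (fun n => c n * z ^ n) l /\
    Clim (fun N => sum_n (fun n => c n * z ^ n * (d (N - n)%nat * e (N + n)%nat)) N)
      (l * (D * E)).
Proof.
intros Hz [Kc Hc] [Kd Hd] [Ke He] HD HE.
pose proof (Cmod_ge_0 z) as Hz0.
pose proof (Rle_trans _ _ _ (Cmod_ge_0 _) (Hc O)) as Kc0.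
pose proof (Rle_trans _ _ _ (Cmod_ge_0 _) (Hd O)) as Kd0.
pose proof (Rle_trans _ _ _ (Cmod_ge_0 _) (He O)) as Ke0.
assert (Hb : forall n x y, (Cmod x <= Kd)%R -> (Cmod y <= Ke)%R ->
  (Cmod (c n * z ^ n * (x * y)) <= Kc * (Kd * Ke) * Cmod z ^ n)%R).
{ intros n x y Hx Hy. rewrite !Cmod_mult, Cmod_pow.
  replace (Kc * (Kd * Ke) * Cmod z ^ n)%R with (Kc * Cmod z ^ n * (Kd * Ke))%R by ring.
  apply Rmult_le_compat; [apply Rmult_le_pos; auto using Cmod_ge_0, pow_le
    |apply Rmult_le_pos; apply Cmod_ge_0| |apply Rmult_le_compat; auto using Cmod_ge_0].
  apply Rmult_le_compat_r; auto using pow_le. }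
destruct (tannery (fun N n => c n * z ^ n * (d (N - n)%nat * e (N + n)%nat))
  (fun n => c n * z ^ n * (D * E)) (Kc * (Kd * Ke)) (Cmod z)) as [l' [Hl' HL]].
- now split.
- auto using Rmult_le_pos.
- intros N n _. now apply Hb.
- intros n. apply Hb; eapply Clim_Cmod_le; eassumption.
- intros n. apply Clim_mult; [apply Clim_const|].
  apply Clim_mult.
  + apply (Clim_subseq d D (fun N => (N - n)%nat)); [|exact HD].
    intros P [N0 HP]. exists (N0 + n)%nat. intros m Hm. apply HP. lia.
  + apply (Clim_subseq e E (fun N => (N + n)%nat)); [|exact HE].
    intros P [N0 HP]. exists N0. intros m Hm. apply HP. lia.
- assert (Hex : ex_series (V := C_CompleteNormedModule) (fun n => c n * z ^ n)).
  { apply (ex_series_le (V := C_CompleteNormedModule) _ (fun n => Kc * Cmod z ^ n)%R).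
    - intros n. change (Cmod (c n * z ^ n) <= Kc * Cmod z ^ n)%R.
      rewrite Cmod_mult, Cmod_pow. apply Rmult_le_compat_r; auto using pow_le.
    - apply (ex_series_scal_l (V := R_NormedModule)), ex_series_geom.
      now rewrite Rabs_pos_eq. }
  destruct Hex as [l Hl]. exists l. split; [exact Hl|].
  replace (l * (D * E)) with l'; [exact HL|].
  apply (Clim_unique (sum_n (fun n => c n * z ^ n * (D * E)))).
  + now apply Clim_filterlim.
  + apply (Clim_ext (fun N => sum_n (fun n => c n * z ^ n) N * (D * E))).
    * intros N. symmetry. apply Csum_mult_r.
    * apply Clim_mult; [now apply Clim_filterlim|apply Clim_const].
Qed.

(** * Bounds and limits of q-shifted factorials and of the Bailey sequence *)

Lemma exp_geometric_le (t : R) (q : C) (n : nat) : (Cmod q < 1)%R -> (0 <= t)%R ->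
  (exp (t * ((1 - Cmod q ^ n) / (1 - Cmod q))) <= exp (t / (1 - Cmod q)))%R.
Proof.
intros Hq Ht.
assert (H : (t * ((1 - Cmod q ^ n) / (1 - Cmod q)) <= t / (1 - Cmod q))%R).
{ unfold Rdiv. apply Rmult_le_compat_l; [exact Ht|].
  rewrite <- (Rmult_1_l (/ _)) at 2.
  apply Rmult_le_compat_r; [left; apply Rinv_0_lt_compat; lra|].
  assert (0 <= Cmod q ^ n)%R by apply pow_le, Cmod_ge_0. lra. }
destruct H as [H|H]; [left; now apply exp_increasing|rewrite H; lra].
Qed.

Lemma qpoch_bounded (x q : C) : (Cmod q < 1)%R -> bounded (qpoch x q).
Proof.
intros Hq. exists (exp (Cmod x / (1 - Cmod q))). intros n.
eapply Rle_trans; [apply qpoch_bound; exact Hq|].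
apply exp_geometric_le; [exact Hq|apply Cmod_ge_0].
Qed.

(* [1/|1-y| <= 1/(1-|y|) = 1+|y|/(1-|y|)] with [y = x q^k] reduces this to
   the estimate used for [qpoch_bound]. *)
Lemma qpoch_inv_bounded (x q : C) :
  (Cmod q < 1)%R -> (Cmod x < 1)%R -> bounded (fun n => / qpoch x q n).
Proof.
intros Hq Hx.
set (t := (Cmod x / (1 - Cmod x))%R).
assert (Ht : (0 <= t)%R) by (apply Rdiv_le_0_compat; [apply Cmod_ge_0|lra]).
exists (exp (t / (1 - Cmod q))). intros n.
enough (H : (Cmod (/ qpoch x q n) <= exp (t * ((1 - Cmod q ^ n) / (1 - Cmod q))))%R).
{ eapply Rle_trans; [exact H|]. now apply exp_geometric_le. }
induction n as [|n IH].
- simpl. rewrite Cmod_inv, Cmod_1 by apply C1_nz.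
  replace (_ * _)%R with 0%R by (field; lra). rewrite exp_0. lra.
- assert (hn : qpoch x q n <> 0) by now apply qpoch_neq_0.
  pose proof (Cmod_mult_pow_lt_1 x q n Hq Hx) as Hy.
  assert (hf : 1 - x * q ^ n <> 0) by now apply one_minus_neq_0.
  rewrite qpoch_S. replace (/ (qpoch x q n * (1 - x * q ^ n)))
    with (/ qpoch x q n * / (1 - x * q ^ n)) by (field; auto).
  rewrite Cmod_mult.
  replace (t * ((1 - Cmod q ^ S n) / (1 - Cmod q)))%R
    with (t * ((1 - Cmod q ^ n) / (1 - Cmod q)) + t * Cmod q ^ n)%R
    by (simpl; field; lra).
  rewrite exp_plus. apply Rmult_le_compat; try apply Cmod_ge_0; [exact IH|].
  eapply Rle_trans; [|apply exp_ineq1_le].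
  rewrite Cmod_inv by exact hf.
  set (y := Cmod (x * q ^ n)) in *.
  assert (H1 : (1 - y <= Cmod (1 - x * q ^ n))%R).
  { pose proof (Cmod_triangle (1 - x * q ^ n) (x * q ^ n)) as T.
    replace (1 - x * q ^ n + x * q ^ n) with (RtoC 1) in T by ring.
    rewrite Cmod_1 in T. unfold y. lra. }
  assert (H2 : (y = Cmod x * Cmod q ^ n)%R) by (unfold y; now rewrite Cmod_mult, Cmod_pow).
  assert (H3 : (0 <= Cmod q ^ n <= 1)%R).
  { split; [apply pow_le, Cmod_ge_0|]. rewrite <- Cmod_pow. now apply Cmod_pow_le_1. }
  pose proof (Cmod_ge_0 x) as H4.
  apply Rle_trans with (/ (1 - y))%R; [apply Rinv_le_contravar; lra|].
  replace (/ (1 - y))%R with (1 + y / (1 - y))%R by (field; lra).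
  apply Rplus_le_compat_l. unfold t. rewrite H2.
  replace (Cmod x / (1 - Cmod x) * Cmod q ^ n)%R
    with (Cmod x * Cmod q ^ n / (1 - Cmod x))%R by (field; lra).
  unfold Rdiv. apply Rmult_le_compat_l; [apply Rmult_le_pos; lra|].
  apply Rinv_le_contravar; nra.
Qed.

Lemma qpoch_Clim (x q : C) : (Cmod q < 1)%R -> Clim (qpoch x q) (qpoch_inf x q).
Proof. intros Hq. now apply Clim_filterlim, qpoch_inf_correct. Qed.

Lemma qpoch_inv_Clim (x q : C) : (Cmod q < 1)%R -> (Cmod x < 1)%R ->
  qpoch_inf x q <> 0 /\ Clim (fun n => / qpoch x q n) (/ qpoch_inf x q).
Proof.
intros Hq Hx. apply Clim_inv.
- intros n. now apply qpoch_neq_0.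
- now apply qpoch_inv_bounded.
- now apply qpoch_Clim.
Qed.

Lemma alpha_bounded (q : C) : (Cmod q < 1)%R -> bounded (alpha q).
Proof.
(* The 4 is the explicit factor 2 times |1 + q^n| <= 2, and |1 + q^(2n)| >= 1 - |q| for n > 0. *)
intros Hq. exists (4 / (1 - Cmod q))%R.
pose proof (Cmod_ge_0 q) as Hq0.
assert (H1 : (4 <= 4 / (1 - Cmod q))%R).
{ apply Rmult_le_reg_r with (1 - Cmod q)%R; [lra|].
  unfold Rdiv. rewrite Rmult_assoc, Rinv_l by lra. lra. }
intros [|n]; unfold alpha.
- rewrite Cmod_1. lra.
- assert (hp : forall k, (Cmod (q ^ k) <= 1)%R) by (intros; now apply Cmod_pow_le_1).
  replace (2 * S n)%nat with (S (S (2 * n))) by lia.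
  assert (H2 : 1 + q ^ S (S (2 * n)) <> 0) by now apply one_plus_neq_0, Cmod_pow_S_lt_1.
  assert (H3 : (1 - Cmod q <= Cmod (1 + q ^ S (S (2 * n))))%R).
  { pose proof (Cmod_triangle (1 + q ^ S (S (2 * n))) (- q ^ S (S (2 * n)))) as T.
    replace (1 + q ^ S (S (2 * n)) + - q ^ S (S (2 * n))) with (RtoC 1) in T by ring.
    rewrite Cmod_1, Cmod_opp, (Cpow_S q), Cmod_mult in T.
    pose proof (hp (S (2 * n))). pose proof (Cmod_ge_0 (q ^ S (2 * n))).
    rewrite (Cpow_S q). nra. }
  assert (H4 : (Cmod (1 + q ^ S n) <= 2)%R).
  { eapply Rle_trans; [apply Cmod_triangle|]. rewrite Cmod_1. specialize (hp (S n)). lra. }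
  unfold Cdiv. rewrite !Cmod_mult, Cmod_inv, (Cmod_pow (- (1))), Cmod_opp, Cmod_1, pow1, Cmod_R,
    Rabs_pos_eq, Rmult_1_r by (assumption || lra).
  replace (4 / (1 - Cmod q))%R with (2 * 1 * 1 * (2 * / (1 - Cmod q)))%R by (field; lra).
  repeat apply Rmult_le_compat; auto using Cmod_ge_0; try lra;
    repeat apply Rmult_le_pos; auto using Cmod_ge_0; try lra;
    try (left; apply Rinv_0_lt_compat; lra).
  apply Rinv_le_contravar; lra.
Qed.

(** * Passage to the limit in the finite Bailey lemma *)

Theorem theorem5p2 (q a b : C)
  (hq0 : q <> 0) (ha0 : a <> 0) (hb0 : b <> 0)
  (hq : (Cmod q < 1)%R)
  (hab : (Rmax (Cmod (a * b / q)) (Rmax (Cmod a) (Cmod b)) < 1)%R) :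
  let v : nat -> C := fun n =>
    (1 + q ^ n) / (1 + q ^ (2 * n)) *
    ((qpoch (q / a) q n * qpoch (q / b) q n) / (qpoch a q n * qpoch b q n)) *
    (- (a * b)) ^ n * q ^ ((n ^ 2 - n) / 2) in
  ex_series (phi32_term (q / a) (q / b) q (Ci * q) (- (Ci * q)) q (a * b / q)) /\
  ex_series (fun n => v (S n)) /\
  (qpoch_inf q q * qpoch_inf (a * b / q) q) / (qpoch_inf a q * qpoch_inf b q) *
    phi32 (q / a) (q / b) q (Ci * q) (- (Ci * q)) q (a * b / q)
  = 1 + 2 * CSeries (fun n => v (S n)).
Proof.
intros v. set (z := a * b / q) in *. set (A := q / a). set (B := q / b).
assert (hz : (Cmod z < 1)%R) by (eapply Rle_lt_trans; [apply Rmax_l|exact hab]).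
assert (ha : (Cmod a < 1)%R).
{ eapply Rle_lt_trans; [|exact hab]. eapply Rle_trans; [apply Rmax_l|apply Rmax_r]. }
assert (hb : (Cmod b < 1)%R).
{ eapply Rle_lt_trans; [|exact hab]. eapply Rle_trans; [apply Rmax_r|apply Rmax_r]. }
assert (hAz : A * z = b) by (unfold A, z; field; auto).
assert (hBz : B * z = a) by (unfold B, z; field; auto).
assert (hABz : A * B * z = q) by (unfold A, B, z; field; auto).
assert (hi : (Cmod (Ci * q) < 1)%R) by (rewrite Cmod_mult, Cmod_Ci; lra).
assert (hi' : (Cmod (- (Ci * q)) < 1)%R) by now rewrite Cmod_opp.
destruct (qpoch_inv_Clim q q hq hq) as [q_inf0 Hq].
destruct (qpoch_inv_Clim a q hq ha) as [a_inf0 _].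
destruct (qpoch_inv_Clim b q hq hb) as [b_inf0 _].
set (Qi := qpoch_inf q q) in *. set (Zi := qpoch_inf z q) in *.
set (ai := qpoch_inf a q) in *. set (bi := qpoch_inf b q) in *.
set (c1 := fun n => qpoch A q n * qpoch B q n *
  (/ qpoch (Ci * q) q n * / qpoch (- (Ci * q)) q n)).
set (c2 := fun n => alpha q n *
  (qpoch A q n * qpoch B q n * (/ qpoch b q n * / qpoch a q n))).
(* On the left side the dependence on N is only through N - n, so the second factor is the constant
   1. *)
destruct (tannery_product c1 (fun k => qpoch z q k * / qpoch q q k) (fun _ => 1) z (Zi * / Qi) 1)
  as [l1 [Hl1 HL]]; auto using qpoch_bounded, qpoch_inv_bounded, bounded_mult, Clim_const.
{ unfold c1. auto using qpoch_bounded, qpoch_inv_bounded, bounded_mult. }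
{ exists 1%R. intros _. rewrite Cmod_1. lra. }
{ apply Clim_mult; [now apply qpoch_Clim|exact Hq]. }
destruct (tannery_product c2 (fun k => / qpoch q q k) (fun k => / qpoch q q k) z (/ Qi) (/ Qi))
  as [l2 [Hl2 HR]]; auto using qpoch_inv_bounded.
{ unfold c2. auto using alpha_bounded, qpoch_bounded, qpoch_inv_bounded, bounded_mult. }
assert (Hphi : is_series (phi32_term A B q (Ci * q) (- (Ci * q)) q z) l1).
{ apply (is_series_ext (fun n => c1 n * z ^ n)); [|exact Hl1].
  intros n. unfold c1, phi32_term. as_C. field.
  repeat split; now apply qpoch_neq_0. }
assert (Hc2 : forall n, c2 (S n) * z ^ S n = 2 * v (S n)).
{ intros n. unfold c2, v, alpha. set (m := S n). set (T := ((m ^ 2 - m) / 2)%nat).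
  (* Since z = ab/q, the power (-ab)^n splits into (-1)^n q^n, which belongs to alpha_n, and z^n. *)
  replace (- (a * b)) with (- (1) * q * z) by (unfold z; field; auto).
  rewrite !Cpow_mult_l. fold A B.
  assert (H2 : 1 + q ^ (2 * m) <> 0).
  { unfold m. replace (2 * S n)%nat with (S (S (2 * n)))%nat by lia.
    now apply one_plus_neq_0, Cmod_pow_S_lt_1. }
  pose proof (qpoch_neq_0 a q m hq ha). pose proof (qpoch_neq_0 b q m hq hb).
  clearbody m T. generalize dependent (q ^ (2 * m)). intros. field. auto. }
(* The term n = 0 of the series for [l2] is 1, because alpha_0 = 1; the other terms are 2 v_n, so l2
   = 1 + 2 sum v_n with the sum starting at n = 1. *)
assert (Hv : is_series (fun n => v (S n)) ((l2 - 1) / 2)).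
{ apply Clim_filterlim.
  apply (Clim_ext (fun N => (sum_n (fun n => c2 n * z ^ n) (S N) + - (1)) * / 2)).
  - intros N. induction N as [|N IH].
    + rewrite Csum_S, !Csum_O, Hc2. unfold c2, alpha. simpl (qpoch _ _ 0).
      simpl (z ^ 0). as_C. field.
    + rewrite Csum_S, (Csum_S (fun n => v (S n))). 
      eapply eq_trans; [|exact (f_equal (fun x : C => x + v (S (S N))) IH)].
      rewrite Hc2.
      generalize (sum_n (fun n => c2 n * z ^ n) (S N)). intros s. change C in s.
      as_C. field.
  - apply Clim_mult; [|apply Clim_const]. apply Clim_plus; [|apply Clim_const].
    apply (Clim_subseq (sum_n (fun n => c2 n * z ^ n)) l2 S).
    + intros P [N0 HP]. exists N0. intros m Hm. apply HP. lia.
    + now apply Clim_filterlim. }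
split; [now exists l1|]. split; [now exists ((l2 - 1) / 2)|].
unfold phi32. rewrite (CSeries_unique _ _ Hphi), (CSeries_unique _ _ Hv).
(* Both sides of the finite lemma converge, and their limits agree. Multiplying by (q;q)_oo squared
   then leaves one such factor on the left and none on the right. *)
assert (E : l1 * (Zi * / Qi * 1) = bi * ai * (l2 * (/ Qi * / Qi))).
{ eapply Clim_unique; [exact HL|].
  eapply Clim_ext; [|apply Clim_mult; [|exact HR];
    apply Clim_mult; apply qpoch_Clim; exact hq].
  intros N. cbv beta.
  pose proof (finite_bailey q A B z (alpha q) N hq) as T. rewrite hAz, hBz in T.
  specialize (T hb ha hABz).
  eapply eq_trans; [|eapply eq_trans; [symmetry; exact T|]].
  - f_equal. apply Csum_ext. intros r _. unfold c2.
    pose proof (qpoch_neq_0 a q r hq ha). pose proof (qpoch_neq_0 b q r hq hb).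
    as_C. field. repeat split; auto using qpoch_neq_0.
  - apply Csum_ext. intros n _. rewrite bailey_pair by exact hq. unfold c1. as_C. field.
    repeat split; now apply qpoch_neq_0. }
assert (E' : l1 * Zi * Qi = ai * bi * l2).
{ transitivity (l1 * (Zi * / Qi * 1) * (Qi * Qi)); [field; exact q_inf0|].
  rewrite E. field. exact q_inf0. }
transitivity (l1 * Zi * Qi / (ai * bi)); [field; auto|].
rewrite E'. field. auto.
Qed.
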